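(* If $G$ is a simple graph with $n$ vertices, then $\mathrm{gon}(G)\le n-\alpha(G)$, where $\alpha(G)$ is the independence number of $G$.
   Context: An independent set in a graph is a set of vertices no two of which are adjacent; the independence number $\alpha(G)$ is the maximum size of an independent set. For a finite graph $G$, a divisor is a formal integer combination $D=\sum_{v\in V(G)} D(v)\,v$ of vertices; its degree is $\sum_v D(v)$, and it is effective if $D(v)\ge 0$ for all $v$. Firing a vertex $v$ means moving one chip from $v$ along each edge incident to $v$; two divisors are equivalent if one can be obtained from the other by a sequence of firings and reverse firings (equivalently, their difference lies in the image of the graph Laplacian). A divisor $D$ has positive rank if for every vertex $v$, $D-v$ is equivalent to an effective divisor. The gonality $\mathrm{gon}(G)$ is the minimum degree of a divisor of positive rank.
   Formalization: The formal theorem assumes that the graph has no isolated vertices; without this the claim fails, e.g. a single vertex has gonality 1 while n − α(G) = 0. *)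

(* Defs.v *)
From Stdlib Require Import Relation_Operators.
From mathcomp Require Import all_boot all_order all_algebra.
From mathcomp Require Import boolp.

Set Implicit Arguments.
Unset Strict Implicit.
Unset Printing Implicit Defensive.

Import Order.TTheory GRing.Theory Num.Theory.
Local Open Scope ring_scope.

(* A simple graph is a finite vertex type with an adjacency relation [e];
   symmetry and irreflexivity of [e] are hypotheses of the theorems. *)

Definition independent (T : finType) (e : rel T) (S : {set T}) : bool :=
  [forall x in S, forall y in S, ~~ e x y].

Definition independence_number (T : finType) (e : rel T) : nat :=
  \max_(S : {set T} | independent e S) #|S|.

Lemma independence_number_le_card (T : finType) (e : rel T) :
  (independence_number e <= #|T|)%N.
Proof. by apply/bigmax_leqP => S _; exact: max_card. Qed.

Definition divisor (T : finType) := {ffun T -> int}.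

Definition divisor_of_vertex (T : finType) (v : T) : divisor T :=
  [ffun w => (w == v)%:Z].

Definition divisor_degree (T : finType) (D : divisor T) : int :=
  \sum_v D v.

Definition effective (T : finType) (D : divisor T) : Prop :=
  forall v, 0 <= D v.

Definition fire (T : finType) (e : rel T) (v : T) (D : divisor T) : divisor T :=
  D - divisor_of_vertex v *+ #|[set u | e v u]|
    + \sum_(u | e v u) divisor_of_vertex u.

Definition fires_to (T : finType) (e : rel T) (D D' : divisor T) : Prop :=
  exists v, D' = fire e v D.

(* The symmetric closure accounts for the reverse firings. *)
Definition equivalent (T : finType) (e : rel T) : divisor T -> divisor T -> Prop :=
  clos_refl_sym_trans (divisor T) (fires_to e).

Definition positive_rank (T : finType) (e : rel T) (D : divisor T) : Prop :=
  forall v, exists2 E : divisor T,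
    equivalent e (D - divisor_of_vertex v) E & effective E.

Definition has_positive_rank_of_degree (T : finType) (e : rel T) (k : nat) : bool :=
  `[< exists2 D : divisor T, positive_rank e D & divisor_degree D = k%:Z >].

Lemma positive_rank_exists (T : finType) (e : rel T) :
  exists k, has_positive_rank_of_degree e k.
Proof.
exists #|T|; apply/asboolP; exists [ffun=> 1].
  move=> v; exists ([ffun=> 1] - divisor_of_vertex v); first exact: rst_refl.
  by move=> w; rewrite !ffunE; case: (w == v).
rewrite /divisor_degree (eq_bigr (fun=> 1)); last by move=> v _; rewrite ffunE.
by rewrite sumr_const; exact: natz.
Qed.

(* The minimum is taken over natural numbers; [gonalityP] shows that it is the
   minimum over all divisors of positive rank, of any integer degree. *)
Definition gonality (T : finType) (e : rel T) : nat :=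
  ex_minn (positive_rank_exists e).

Lemma divisor_degreeD (T : finType) (D E : divisor T) :
  divisor_degree (D + E) = divisor_degree D + divisor_degree E.
Proof. by rewrite -big_split; apply: eq_bigr => v _; rewrite ffunE. Qed.

Lemma divisor_degreeN (T : finType) (D : divisor T) :
  divisor_degree (- D) = - divisor_degree D.
Proof. by rewrite -sumrN; apply: eq_bigr => v _; rewrite ffunE. Qed.

Lemma divisor_degree_vertex (T : finType) (v : T) :
  divisor_degree (divisor_of_vertex v) = 1.
Proof.
rewrite /divisor_degree (bigD1 v) //= ffunE eqxx big1 ?addr0 // => w /negPf vw.
by rewrite ffunE vw.
Qed.

Lemma divisor_degree_fire (T : finType) (e : rel T) (v : T) (D : divisor T) :
  divisor_degree (fire e v D) = divisor_degree D.
Proof.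
have degS (A : pred T) : divisor_degree (\sum_(u | A u) divisor_of_vertex u) = #|A|%:Z.
  rewrite (big_morph _ (@divisor_degreeD T) (_ : divisor_degree 0 = 0)).
    rewrite (eq_bigr (fun=> 1)) ?sumr_const; last by move=> u _; exact: divisor_degree_vertex.
    exact: natz.
  by apply: big1 => u _; rewrite ffunE.
have degM n : divisor_degree (divisor_of_vertex v *+ n) = n%:Z.
  elim: n => [|n IH]; first by apply: big1 => u _; rewrite mulr0n ffunE.
  by rewrite mulrS divisor_degreeD IH divisor_degree_vertex.
rewrite /fire !divisor_degreeD divisor_degreeN degS degM cardsE.
by rewrite subrK.
Qed.

Lemma divisor_degree_equivalent (T : finType) (e : rel T) (D E : divisor T) :
  equivalent e D E -> divisor_degree D = divisor_degree E.
Proof.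
by elim=> // [? ? [v ->]|? ? ? _ -> _ ->] //; rewrite divisor_degree_fire.
Qed.

Lemma positive_rank_degree_ge0 (T : finType) (e : rel T) (D : divisor T) :
  positive_rank e D -> 0 <= divisor_degree D.
Proof.
move=> rD; case: (pickP (@predT T)) => [v _|T0]; last first.
  by rewrite /divisor_degree big_pred0.
have [E /divisor_degree_equivalent DE E0] := rD v.
have : 0 <= divisor_degree E by apply: sumr_ge0 => w _; exact: E0.
rewrite -DE divisor_degreeD divisor_degreeN divisor_degree_vertex subr_ge0.
exact: le_trans.
Qed.

Lemma gonalityP (T : finType) (e : rel T) :
  (exists2 D : divisor T, positive_rank e D & divisor_degree D = (gonality e)%:Z)
  /\ (forall D : divisor T, positive_rank e D -> (gonality e)%:Z <= divisor_degree D).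
Proof.
rewrite /gonality; case: ex_minnP => m /asboolP m_ok m_min; split=> // D rD.
have := positive_rank_degree_ge0 rD.
case dD: (divisor_degree D) => [k|//] _; rewrite lez_nat; apply: m_min.
by apply/asboolP; exists D.
Qed.

(* Main.v *)
(** Let [S] be a maximum independent set, and put one chip on each vertex
    outside [S].  A vertex of [S] has at least one neighbour, and all its
    neighbours carry a chip, so a reverse firing moves chips onto it without
    creating debt. *)
Require Import Defs.
From mathcomp Require Import all_boot all_order all_algebra.
From Stdlib Require Import Relation_Operators.

Import Order.TTheory GRing.Theory Num.Theory.

Lemma independence_number_attained (T : finType) (e : rel T) :
  exists2 S : {set T}, independent e S & independence_number e = #|S|.
Proof.
(* A maximum over an empty family would be 0 by default and attained by nothing; the empty set rules
   this out. *)
have ind0 : (0 < #|[pred S : {set T} | independent e S]|)%N.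
  apply/card_gt0P; exists set0.
  by apply/forall_inP => x; rewrite inE.
by have [S indS maxS] := eq_bigmax_cond (fun S : {set T} => #|S|) ind0; exists S.
Qed.

Section ComplementDivisor.
Local Open Scope ring_scope.
Context {T : finType}.
Implicit Types (e : rel T) (S : {set T}) (D : divisor T) (v w : T).

Definition complement_divisor S : divisor T := [ffun w => (w \notin S)%:Z].

Lemma complement_divisor_degree S :
  divisor_degree (complement_divisor S) = (#|T| - #|S|)%N%:Z.
Proof.
have -> : (#|T| - #|S|)%N = #|~: S| by rewrite [RHS]cardsCs setCK.
rewrite -natz -sum1_card natr_sum big_mkcond /=.
by apply: eq_bigr => v _; rewrite ffunE inE; case: (v \in S).
Qed.

(** Only the summand [u = w] contributes at [w], so a reverse firing takes at most one chip from
    each vertex. *)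
Lemma sum_divisor_of_vertexE (A : pred T) w :
  (\sum_(u | A u) divisor_of_vertex u) w = (A w)%:Z.
Proof.
rewrite sum_ffunE; case: (boolP (A w)) => Aw.
  rewrite (bigD1 w) //= ffunE eqxx big1 ?addr0 // => u /andP[_ uw].
  by rewrite ffunE eq_sym (negPf uw).
by rewrite big1 // => u Au; rewrite ffunE; case: eqP => // wu; rewrite wu Au in Aw.
Qed.

Definition unfire e v D : divisor T :=
  D + divisor_of_vertex v *+ #|[set u | e v u]|
    - \sum_(u | e v u) divisor_of_vertex u.

Lemma equivalent_unfire e v D : equivalent e D (unfire e v D).
Proof.
(* Firing [v] from [unfire e v D] gives back [D]. *)
apply/rst_sym/rst_step; exists v.
by rewrite /fire /unfire addrAC subrK addrK.
Qed.

Lemma complement_divisor_positive_rank e S :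
  irreflexive e -> (forall v, exists w, e v w) -> independent e S ->
  positive_rank e (complement_divisor S).
Proof.
move=> e_irr e_noiso indS v; have [vS|vNS] := boolP (v \in S); last first.
  (* Outside [S] the chip on [v] itself is removed, so no debt arises. *)
  exists (complement_divisor S - divisor_of_vertex v); first exact: rst_refl.
  by move=> w; rewrite !ffunE; case: eqP => [->|_]; rewrite ?vNS ?subr0.
exists (unfire e v (complement_divisor S - divisor_of_vertex v)).
  exact: equivalent_unfire.
move=> w; rewrite /unfire ffunE ffunE [X in _ + X]ffunE sum_divisor_of_vertexE.
rewrite ffunMnE !ffunE; have [->|_] := eqVneq w v.
  (* At [v] the debt of one chip is repaid by the neighbours, of which there is at least one. *)
  rewrite vS e_irr subr0 sub0r addrC subr_ge0 natz lez_nat.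
  by have [u vu] := e_noiso v; apply/card_gt0P; exists u; rewrite inE.
rewrite mul0rn subr0 addr0 subr_ge0 lez_nat.
(* Outside [S], [w] has the one chip it may have to give; inside [S], independence means that it
   gives none. *)
have [wS|_] := boolP (w \in S); last by case: (e v w).
by have /forall_inP/(_ v vS)/forall_inP/(_ w wS)/negPf -> := indS.
Qed.

End ComplementDivisor.

Theorem theorem3p1 (T : finType) (e : rel T) (n : nat)
  (e_sym : symmetric e) (e_irr : irreflexive e)
  (e_noiso : forall v : T, exists w : T, e v w)
  (hn : #|T| = n) :
  gonality e <= n - independence_number e.
Proof.
have [S indS ->] := independence_number_attained T e.
(* Over the integers the bound becomes the degree of a divisor, to which the minimality in
   [gonalityP] applies. *)
rewrite -hn -lez_nat -complement_divisor_degree.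
exact/(proj2 (gonalityP e))/complement_divisor_positive_rank.
Qed.
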